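(* Let $P(s)=\dfrac{\beta_0 s+\beta_1}{s-p}$ with $p>0$, $\beta_0\ge 0$ and $\beta_1\neq 0$ real. Then the following hold. (i) If $\beta_0>0$, then $$k_M^{PI}=k_M^{P}=\begin{cases}\max\left\{\dfrac{|\beta_1|/\beta_0}{p},\ \dfrac{p}{|\beta_1|/\beta_0}\right\}, & \beta_1<0,\\[2mm] \infty, & \beta_1>0,\end{cases}$$ $$\theta_M^{PI}=\theta_M^{P}=\begin{cases}\cos^{-1}\dfrac{2\sqrt{\beta_0|\beta_1|/p}}{\beta_0+(|\beta_1|/p)}, & \beta_1<0,\\[2mm] \pi, & \beta_1>0.\end{cases}$$ (ii) If $\beta_0=0$, then $$k_M^{PID}=k_M^{PD}=k_M^{P}=\infty,\qquad \theta_M^{PID}=\theta_M^{PD}=2\theta_M^{P}=\pi.$$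
   Context: Controllers: $K_P(s)=k_p$; $K_{PI}(s)=k_p+k_i/s$; $K_{PD}(s)=k_p+k_d s$; $K_{PID}(s)=k_p+k_i/s+k_d s$, with real coefficients (possibly zero), so each P controller is also a PI, PD and PID controller. Stabilization (unity negative feedback): write the plant as $P=N_P/D_P$ with numerator and denominator polynomials exactly as displayed (no cancellation of common factors is performed) and a controller as $K=N_K/D_K$ with $N_K,D_K$ coprime real polynomials. For a nonzero complex number $c$, $K$ stabilizes $cP$ if $\deg(N_PN_K)\le\deg(D_PD_K)$ and the closed-loop characteristic polynomial $D_PD_K+cN_PN_K$ has degree $\deg(D_PD_K)$ and all its roots in the open left half-plane. Margins: for a controller type $X\in\{P,PI,PD,PID\}$, $k_M^{X}=\sup\{\mu:\ \exists K \text{ of type } X \text{ stabilizing } \alpha P \text{ for all }\alpha\in[1,\mu)\}$ and $\theta_M^{X}=\sup\{\eta\in[0,\pi]:\ \exists K\text{ of type }X\text{ stabilizing } e^{-j\theta}P\text{ for all }\theta\in(-\eta,\eta)\}$, where $j=\sqrt{-1}$; one and the same controller must work for the whole range of $\alpha$ (resp. $\theta$). *)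

(* Defs.v *)
From HB Require Import structures.
From mathcomp Require Import all_boot all_order all_algebra.
From mathcomp Require Import all_classical all_reals all_analysis.
From mathcomp Require Import complex.

Set Implicit Arguments.
Unset Strict Implicit.
Unset Printing Implicit Defensive.

Import Order.TTheory GRing.Theory Num.Theory.
Local Open Scope classical_set_scope.
Local Open Scope ring_scope.
Local Open Scope complex_scope.

(* A plant is a pair of numerator and denominator polynomials, not a rational
   function: its common factors must not cancel.  A controller is a rational
   function, and only its coprime fractions N_K / D_K are used. *)

Inductive controller_type := TP | TPI | TPD | TPID.

Definition PID_controller (R : realType) (kp ki kd : R) : {fraction {poly R}} :=
  FracField.tofrac kp%:P
  + FracField.tofrac ki%:P / FracField.tofrac 'X
  + FracField.tofrac (kd *: 'X).

Definition of_type (R : realType) (X : controller_type)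
    (K : {fraction {poly R}}) : Prop :=
  match X with
  | TP => exists kp, K = PID_controller kp 0 0
  | TPI => exists kp ki, K = PID_controller kp ki 0
  | TPD => exists kp kd, K = PID_controller kp 0 kd
  | TPID => exists kp ki kd, K = PID_controller kp ki kd
  end.

Definition complex_poly (R : realType) (q : {poly R}) : {poly R[i]} :=
  map_poly (real_complex R) q.

Definition char_poly_cl (R : realType) (NP DP NK DK : {poly R}) (c : R[i]) :
    {poly R[i]} :=
  complex_poly (DP * DK) + c *: complex_poly (NP * NK).

(* [size] is one plus the degree, so comparing sizes compares degrees (with
   degree minus infinity for the zero polynomial).  The coprime fraction of K
   is unique up to a common nonzero constant, which affects none of the
   conditions below. *)
Definition stabilizes (R : realType) (NP DP : {poly R}) (c : R[i])
    (K : {fraction {poly R}}) : Prop :=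
  exists NK DK : {poly R},
    [/\ DK != 0,
        coprimep NK DK &
        K = FracField.tofrac NK / FracField.tofrac DK] /\
    [/\ (size (NP * NK)%R <= size (DP * DK)%R)%N,
        size (char_poly_cl NP DP NK DK c) = size (DP * DK) &
        forall z : R[i], root (char_poly_cl NP DP NK DK c) z -> complex.Re z < 0].

Definition gain_margin (R : realType) (X : controller_type)
    (NP DP : {poly R}) : \bar R :=
  ereal_sup [set mu%:E | mu in [set mu : R |
    exists K, of_type X K /\
      forall alpha : R, 1 <= alpha < mu -> stabilizes NP DP alpha%:C K]].

(* The set is bounded by pi and contains 0, for which the open interval of
   angles is empty, so the real-valued [sup] is a genuine supremum. *)
Definition phase_margin (R : realType) (X : controller_type)
    (NP DP : {poly R}) : R :=
  sup [set eta : R | 0 <= eta <= pi /\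
    exists K, of_type X K /\
      forall theta : R, - eta < theta < eta ->
        stabilizes NP DP (cos theta -i* sin theta) K].

(* Main.v *)
(* A loop with closed-loop polynomial A s + B is stable iff Re (B conj A) > 0,
   which turns the P (and, for beta0 = 0, the PD) margins into scalar
   inequalities in the gain.  For a PI controller only two necessary conditions
   on A s^2 + B s + C are needed: Re (B conj A) > 0 and, for real coefficients,
   A C > 0.  When beta1 < 0 they imply that the proportional part alone already
   stabilizes every plant of the family, so integral action gains nothing; when
   beta1 > 0, a P controller attains the trivial upper bounds.  For beta0 = 0 a
   PD controller stabilizes at all angles at once. *)
Require Import Defs.
From mathcomp Require Import all_boot all_order all_algebra.
From mathcomp Require Import all_classical all_reals all_analysis.
From mathcomp Require Import complex ring lra.

Set Implicit Arguments.
Unset Strict Implicit.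
Unset Printing Implicit Defensive.

Import Order.TTheory GRing.Theory Num.Theory.
Local Open Scope ring_scope.
Local Open Scope complex_scope.

(** * Independence of stabilization from the coprime fraction chosen for [K] *)

(** After cross-multiplication, Gauss's lemma makes each denominator divide the other, so they agree
    up to a nonzero constant, which cancellation carries over to the numerators. *)
Lemma tofrac_ratio_inj (F : fieldType) (N D N' D' : {poly F}) :
  D != 0 -> D' != 0 -> coprimep N D -> coprimep N' D' ->
  FracField.tofrac N' / FracField.tofrac D'
    = FracField.tofrac N / FracField.tofrac D ->
  exists2 u : F, u != 0 & N' = u *: N /\ D' = u *: D.
Proof.
move=> D0 D'0 cND cND' /eqP; rewrite eqr_div ?tofrac_eq0// -!tofracM tofrac_eq.
move=> /eqP E.
have dD : D %| D'.
  by rewrite -(@Gauss_dvdpr _ D' N) 1?coprimep_sym// -E dvdp_mull.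
have dD' : D' %| D.
  by rewrite -(@Gauss_dvdpr _ D N') 1?coprimep_sym// E dvdp_mull.
have /eqpP[[a b] /= /andP[a0 b0] abE] : D' %= D by rewrite /eqp dD dD'.
have D'E : D' = (b / a) *: D.
  by rewrite mulrC -scalerA -abE scalerA mulVf// scale1r.
exists (b / a); first by rewrite mulf_neq0 ?invr_eq0.
split=> //; apply/(mulIf D0); rewrite E D'E -scalerAl -scalerAr.
by [].
Qed.

(** Another coprime fraction only scales the closed-loop polynomial by a nonzero constant, which
    preserves sizes and roots; hence one convenient fraction decides [stabilizes]. *)
Lemma stabilizes_frac (R : realType) (NP DP N D : {poly R}) (c : R[i]) K :
  D != 0 -> coprimep N D -> K = FracField.tofrac N / FracField.tofrac D ->
  stabilizes NP DP c K <->
  [/\ (size (NP * N)%R <= size (DP * D)%R)%N,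
      size (char_poly_cl NP DP N D c) = size (DP * D) &
      forall z : R[i], root (char_poly_cl NP DP N D c) z -> complex.Re z < 0].
Proof.
move=> D0 cND KE; split; last by move=> ?; exists N, D.
move=> [N' [D' [[D'0 cND' KE'] ]]].
have [u u0 [-> ->]] : exists2 u : R, u != 0 & N' = u *: N /\ D' = u *: D.
  by apply: tofrac_ratio_inj => //; rewrite -KE -KE'.
have uC0 : u%:C != 0 :> R[i] by rewrite (fmorph_eq0 (real_complex R)).
have -> : char_poly_cl NP DP (u *: N) (u *: D) c
    = u%:C *: char_poly_cl NP DP N D c.
  rewrite /char_poly_cl /complex_poly -!scalerAr.
  rewrite -!mul_polyC !rmorphM /= !map_polyC /=.
  rewrite -?mul_polyC; ring.
rewrite -!scalerAr !size_scale//= => -[? ? H]; split=> // z rz.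
by apply: H; rewrite rootZ.
Qed.

(** * Closed-loop polynomials with explicit coefficients *)

Lemma complex_poly_quad (R : realType) (a b d : R) :
  complex_poly (a *: 'X^2 + b *: 'X + d%:P)
    = a%:C *: 'X^2 + b%:C *: 'X + (d%:C)%:P.
Proof.
rewrite /complex_poly !rmorphD /= map_polyC /= -!mul_polyC !rmorphM /=.
by rewrite !map_polyC /= !map_polyX expr2.
Qed.

Lemma char_poly_cl_quad (R : realType) (NP DP N D : {poly R}) (c : R[i])
    (a b d a' b' d' : R) :
  DP * D = a *: 'X^2 + b *: 'X + d%:P ->
  NP * N = a' *: 'X^2 + b' *: 'X + d'%:P ->
  char_poly_cl NP DP N D c =
    (a%:C + c * a'%:C) *: 'X^2 + (b%:C + c * b'%:C) *: 'X
      + (d%:C + c * d'%:C)%:P.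
Proof.
move=> ED EN; rewrite /char_poly_cl ED EN !complex_poly_quad -!mul_polyC.
rewrite !(rmorphD, rmorphM) /=; ring.
Qed.

(** * Left half-plane root conditions in degrees one and two *)

Lemma size_linear (F : idomainType) (a b : F) :
  a != 0 -> size (a *: 'X + b%:P) = 2.
Proof.
move=> a0; rewrite -mul_polyC size_MXaddC polyC_eq0 (negPf a0) /=.
by rewrite size_polyC a0.
Qed.

Lemma size_linear_le (F : idomainType) (a b : F) :
  (size (a *: 'X + b%:P)%R <= 2)%N.
Proof.
rewrite (leq_trans (size_polyD _ _))// geq_max size_polyC.
rewrite (leq_trans (size_scale_leq _ _)) ?size_polyX//.
by rewrite (leq_trans (leq_b1 _)).
Qed.

(* The root is [- B / A], whose real part has the sign of [- Re (B conj A)]. *)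
Lemma hurwitz_linear (R : realType) (A B : R[i]) :
  size (A *: 'X + B%:P) = 2 /\
    (forall z : R[i], root (A *: 'X + B%:P) z -> complex.Re z < 0) <->
  0 < complex.Re A * complex.Re B + complex.Im A * complex.Im B.
Proof.
have key z : root (A *: 'X + B%:P) z ->
    complex.Re A * complex.Re B + complex.Im A * complex.Im B =
      - (complex.Re A ^+ 2 + complex.Im A ^+ 2) * complex.Re z.
  rewrite rootE !hornerE addr_eq0 => /eqP.
  by case: A B z => [a a'] [b b'] [x y] [] /= bE b'E; rewrite -[b]opprK
    -[b']opprK -bE -b'E; ring.
split=> [[s2 H]|H].
  have A0 : A != 0.
    apply/eqP => A0; move: s2; rewrite A0 scale0r add0r size_polyC.
    by case: (B != 0).
  have r : root (A *: 'X + B%:P) (- B / A).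
    by rewrite rootE hornerD hornerZ hornerX hornerC mulrC divfK// addNr.
  rewrite (key _ r) mulNr -mulrN mulr_gt0 ?oppr_gt0 ?H//.
  rewrite lt0r addr_ge0 ?sqr_ge0// andbT paddr_eq0 ?sqr_ge0// !sqrf_eq0.
  by apply: contra A0 => /andP[]; case: A {key r s2 H} => ? ? /= /eqP-> /eqP->.
have A0 : A != 0 by apply/eqP => A0; move: H; rewrite A0 /= !mul0r addr0 ltxx.
split=> [|z rz]; first exact: size_linear.
move: H; rewrite (key _ rz); have := sqr_ge0 (complex.Re A).
have := sqr_ge0 (complex.Im A); nra.
Qed.

(* By Vieta, the sum of the roots is [- B / A] and their product is [C / A]. *)
Lemma hurwitz_quadratic (R : realType) (A B C : R[i]) :
  let q := A *: 'X^2 + B *: 'X + C%:P in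
  size q = 3 -> (forall z : R[i], root q z -> complex.Re z < 0) ->
  0 < complex.Re A * complex.Re B + complex.Im A * complex.Im B /\
  (complex.Im A = 0 -> complex.Im B = 0 -> complex.Im C = 0 ->
     0 < complex.Re A * complex.Re C).
Proof.
move=> q s3 H.
have [r qE] := closed_field_poly_normal q.
have l0 : lead_coef q != 0 by rewrite lead_coef_eq0 -size_poly_eq0 s3.
have : size r = 2.
  by move: s3; rewrite {1}qE size_scale// size_prod_XsubC => -[].
case: r qE => [|z1 [|z2 []]]// qE _.
have lE : lead_coef q = A.
  by rewrite /lead_coef s3 /q !(coefE, coefXn, coefX, coefC) /= !mulr0 !addr0 mulr1.
have Hz z : z \in [:: z1; z2] -> complex.Re z < 0.
  by move=> zr; apply: H; rewrite qE rootZ// root_prod_XsubC.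
have x1 : complex.Re z1 < 0 by rewrite Hz ?inE ?eqxx.
have x2 : complex.Re z2 < 0 by rewrite Hz ?inE ?eqxx ?orbT.
move: qE l0; rewrite lE => qE A0.
have {}qE : q = A *: 'X^2 + (- (A * (z1 + z2))) *: 'X + (A * z1 * z2)%:P.
  rewrite {1}qE big_cons big_seq1 -!mul_polyC !(rmorphN, rmorphM, rmorphD) /=.
  ring.
have BE : B = - (A * (z1 + z2)).
  by have := congr1 (fun s : {poly R[i]} => s`_1) qE; rewrite /q /= !coefE /=
    !(mulr0, mulr1, addr0, add0r).
have CE : C = A * z1 * z2.
  by have := congr1 (fun s : {poly R[i]} => s`_0) qE; rewrite /q /= !coefE /=
    !(mulr0, mulr1, addr0, add0r).
move: A0; rewrite BE CE; clear - x1 x2.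
case: A z1 z2 x1 x2 => [a a'] [u1 v1] [u2 v2] /= x1 x2.
rewrite eq_complex /= negb_and => A0.
have Apos : 0 < a ^+ 2 + a' ^+ 2.
  rewrite lt0r addr_ge0 ?sqr_ge0// andbT paddr_eq0 ?sqr_ge0// !sqrf_eq0.
  by rewrite negb_and.
split; first nra.
(* With [A] real and nonzero, [Im B = 0] forces opposite imaginary parts of the roots, so their
   product has real part [u1 * u2 + v1 ^+ 2 > 0]. *)
move=> a'0; subst a'; rewrite !mul0r !(addr0, subr0) => /eqP.
rewrite oppr_eq0 mulf_eq0 => /orP[/eqP a0|/eqP/addr0_eq v1E].
  by move: Apos; rewrite a0 expr0n /= addr0 ltxx.
have {}Apos : 0 < a ^+ 2 by nra.
rewrite -v1E => _.
have -> : a * (a * u1 * u2 - a * v1 * - v1) = a ^+ 2 * (u1 * u2 + v1 ^+ 2) by ring.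
rewrite mulr_gt0// ltr_wpDr ?sqr_ge0//; nra.
Qed.

(** * Controllers as fractions, and the resulting stability conditions *)

Lemma PD_controllerE (R : realType) (kp kd : R) :
  PID_controller kp 0 kd
    = FracField.tofrac (kd *: 'X + kp%:P) / FracField.tofrac 1.
Proof.
rewrite /PID_controller polyC0 tofrac0 mul0r addr0 tofrac1 divr1 addrC.
by rewrite -tofracD.
Qed.

Lemma PI_controllerE (R : realType) (kp ki : R) :
  PID_controller kp ki 0
    = FracField.tofrac (kp *: 'X + ki%:P) / FracField.tofrac 'X.
Proof.
rewrite /PID_controller scale0r tofrac0 addr0 -mul_polyC.
rewrite tofracD tofracM mulrDl mulfK// tofrac_eq0 polyX_eq0//.
Qed.

(** The hypothesis [beta0 * kd = 0] removes the quadratic term; it covers P control, and PD control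
    of a plant with constant numerator. The closed loop is then [(1 + c u) s + (c v - p)] with
    [c = x + i y], to which [hurwitz_linear] applies. *)
Lemma stabilizes_PD (R : realType) (p beta0 beta1 kp kd x y : R) :
  beta0 * kd = 0 ->
  let u := beta0 * kp + beta1 * kd in let v := beta1 * kp in
  stabilizes (beta0 *: 'X + beta1%:P) ('X - p%:P) (x +i* y)
    (PID_controller kp 0 kd) <->
  0 < (1 + x * u) * (x * v - p) + y ^+ 2 * u * v.
Proof.
move=> bk0 u v.
have ED : ('X - p%:P) * 1 = 0 *: 'X^2 + 1 *: 'X + (- p)%:P :> {poly R}.
  by rewrite mulr1 scale0r add0r scale1r polyCN.
have EN : (beta0 *: 'X + beta1%:P) * (kd *: 'X + kp%:P)
    = 0 *: 'X^2 + u *: 'X + v%:P.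
  rewrite -bk0 /u /v -!mul_polyC !(rmorphD, rmorphM) /=; ring.
rewrite (stabilizes_frac _ _ _ (oner_neq0 _) (coprimep1 _) (PD_controllerE _ _)).
have C0 : 0%:C + (x +i* y) * 0%:C = 0 :> R[i].
  by apply/eqP; rewrite eq_complex /= !mulr0 addr0 subr0 !addr0 eqxx.
rewrite (char_poly_cl_quad _ ED EN) EN ED C0 !scale0r !add0r.
rewrite (size_linear _ (oner_neq0 _)).
have := hurwitz_linear (1%:C + (x +i* y) * u%:C) ((- p)%:C + (x +i* y) * v%:C).
rewrite (_ : complex.Re _ * _ + _ = (1 + x * u) * (x * v - p) + y ^+ 2 * u * v).
  by move=> <-; split=> [[_ ? ?]|[? ?]]; split=> //; exact: size_linear_le.
by rewrite /=; ring.
Qed.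

(** Since [ki != 0], the fraction [(kp s + ki) / s] is coprime and the closed loop is quadratic. The
    two conclusions are the conditions on the sum of the roots and, for real [c], on their
    product. *)
Lemma stabilizes_PI_necessary (R : realType) (p beta0 beta1 kp ki x y : R) :
  ki != 0 ->
  stabilizes (beta0 *: 'X + beta1%:P) ('X - p%:P) (x +i* y)
    (PID_controller kp ki 0) ->
  let u := beta0 * kp in let v := beta0 * ki + beta1 * kp in
  0 < (1 + x * u) * (x * v - p) + y ^+ 2 * u * v /\
  (y = 0 -> 0 < (1 + x * u) * (x * (beta1 * ki))).
Proof.
move=> ki0 st u v.
have ED : ('X - p%:P) * 'X = 1 *: 'X^2 + (- p) *: 'X + 0%:P :> {poly R}.
  rewrite -!mul_polyC rmorphN /=; ring.
have EN : (beta0 *: 'X + beta1%:P) * (kp *: 'X + ki%:P)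
    = u *: 'X^2 + v *: 'X + (beta1 * ki)%:P.
  rewrite /u /v -!mul_polyC !(rmorphD, rmorphM) /=; ring.
have cND : coprimep (kp *: 'X + ki%:P) 'X.
  by rewrite coprimepX rootE hornerD hornerZ hornerX hornerC mulr0 add0r.
have := st.
rewrite (stabilizes_frac _ _ _ _ cND (PI_controllerE _ _)) ?polyX_eq0//.
rewrite (char_poly_cl_quad _ ED EN) => -[_].
rewrite size_mulX ?polyXsubC_eq0// size_XsubC => s H.
have [h1 h2] := hurwitz_quadratic s H.
split.
  move: h1; rewrite (_ : complex.Re _ * _ + _ =
    (1 + x * u) * (x * v - p) + y ^+ 2 * u * v)//.
  by rewrite /=; ring.
move=> y0; move: h2; rewrite y0 /= !(mulr0, mul0r, addr0, add0r, subr0).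
by apply.
Qed.

(* Write c = x + i y.  The sum-of-roots condition for the PI loop is that of
   the P loop plus a multiple of [beta0 * ki * (x + beta0 * kp)]. *)
Lemma PI_sum_split (R : realType) (p beta0 beta1 kp ki x y : R) :
  (1 + x * (beta0 * kp)) * (x * (beta0 * ki + beta1 * kp) - p)
    + y ^+ 2 * (beta0 * kp) * (beta0 * ki + beta1 * kp) =
  (1 + x * (beta0 * kp)) * (x * (beta1 * kp) - p)
    + y ^+ 2 * (beta0 * kp) * (beta1 * kp)
    + beta0 * ki * (x + (x ^+ 2 + y ^+ 2) * (beta0 * kp)).
Proof. ring. Qed.

Lemma stabilizes_P (R : realType) (p beta0 beta1 kp x y : R) :
  stabilizes (beta0 *: 'X + beta1%:P) ('X - p%:P) (x +i* y)
    (PID_controller kp 0 0) <->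
  0 < (1 + x * (beta0 * kp)) * (x * (beta1 * kp) - p)
    + y ^+ 2 * (beta0 * kp) * (beta1 * kp).
Proof. by rewrite stabilizes_PD ?mulr0 ?addr0. Qed.

(** * Dropping the integral term when [beta1 < 0] *)

(** As [beta1 < 0], the product condition makes [(1 + x * (beta0 * kp)) * x * ki] negative. Up to
    the factor [beta0] this is the integral term of [PI_sum_split] at [y = 0], so removing it only
    increases the sum expression. *)
Lemma stabilizes_PI_P_real (R : realType) (p beta0 beta1 kp ki x : R) :
  0 < beta0 -> beta1 < 0 ->
  stabilizes (beta0 *: 'X + beta1%:P) ('X - p%:P) x%:C
    (PID_controller kp ki 0) ->
  stabilizes (beta0 *: 'X + beta1%:P) ('X - p%:P) x%:C
    (PID_controller kp 0 0).
Proof.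
move=> b0 b1; have [->//|ki0] := eqVneq ki 0.
move=> /(stabilizes_PI_necessary ki0)/= [sum_gt0 /(_ erefl) prod_gt0].
apply/stabilizes_P; move: sum_gt0; rewrite PI_sum_split => sum_gt0.
apply: (lt_le_trans sum_gt0); rewrite gerDl.
have h : (1 + x * (beta0 * kp)) * x * ki < 0.
  by rewrite -(nmulr_lgt0 _ b1) (_ : _ * beta1 =
    (1 + x * (beta0 * kp)) * (x * (beta1 * ki)))//; ring.
rewrite (_ : _ * _ = beta0 * ((1 + x * (beta0 * kp)) * x * ki)); last by ring.
by rewrite pmulr_rle0// ltW.
Qed.

(* If the margin exceeded the angle whose cosine is [- beta0 * kp], the integral
   term would drop out of the sum-of-roots condition there, and what remains
   is [- p * sin^2 > 0]. *)
Lemma stabilizes_PI_P_phase (R : realType) (p beta0 beta1 kp ki eta : R) :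
  0 < p -> 0 < beta0 -> beta1 < 0 -> eta <= pi ->
  (forall theta : R, - eta < theta < eta ->
    stabilizes (beta0 *: 'X + beta1%:P) ('X - p%:P)
      (cos theta -i* sin theta) (PID_controller kp ki 0)) ->
  forall theta : R, - eta < theta < eta ->
    stabilizes (beta0 *: 'X + beta1%:P) ('X - p%:P)
      (cos theta -i* sin theta) (PID_controller kp 0 0).
Proof.
move=> p0 b0 b1 etapi st theta htheta.
have [ki0|ki0] := eqVneq ki 0; first by move: st; rewrite ki0; apply.
have sum_gt0 (t : R) : - eta < t < eta ->
    0 < (1 + cos t * (beta0 * kp)) * (cos t * (beta1 * kp) - p)
      + (- sin t) ^+ 2 * (beta0 * kp) * (beta1 * kp)
      + beta0 * ki * (cos t + beta0 * kp).
  move=> /st/(stabilizes_PI_necessary ki0)/= [+ _].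
  by rewrite PI_sum_split sqrrN cos2Dsin2 mul1r.
(* Angle zero is the case [c = 1], where the product condition fixes the sign of [(1 + u) * ki]. *)
have st0 : stabilizes (beta0 *: 'X + beta1%:P) ('X - p%:P) 1%:C
    (PID_controller kp ki 0).
  have : - eta < 0 < eta by lra.
  by move=> /st; rewrite cos0 sin0 oppr0.
have [_ /(_ erefl)] := stabilizes_PI_necessary ki0 st0.
have /stabilizes_P := stabilizes_PI_P_real b0 b1 st0.
rewrite expr0n /= !mul0r addr0 !mul1r.
set u := beta0 * kp; set v := beta1 * kp => P0 prod0.
have {}prod0 : (1 + u) * ki < 0.
  by rewrite -(nmulr_lgt0 _ b1) -mulrA [ki * _]mulrC.
apply/stabilizes_P; rewrite -/u -/v.
apply: (lt_le_trans (sum_gt0 _ htheta)); rewrite gerDl -mulrA pmulr_rle0//.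
(* It remains to see that [ki * (cos theta + u) <= 0]. If [1 + u < 0], then [ki > 0] and
   [cos theta + u <= 1 + u] settles every angle. *)
have [u1|u1] := ltP (1 + u) 0.
  have ki_gt0 : 0 < ki by rewrite nmulr_rlt0 in prod0.
  rewrite pmulr_rle0//; rewrite -/u; have := cos_le1 theta; lra.
have {}u1 : 0 < 1 + u.
  rewrite lt_neqAle u1 andbT; apply: contraTneq prod0 => <-.
  by rewrite mul0r ltxx.
have ki_lt0 : ki < 0 by rewrite pmulr_rlt0 in prod0.
have v_gtp : p < v by rewrite pmulr_rgt0// subr_gt0 in P0.
have u_lt0 : u < 0
  by rewrite /u pmulr_rlt0// -(nmulr_rgt0 _ b1) (lt_trans p0).
rewrite -/u nmulr_rle0// leNgt; apply/negP => cos_lt.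
(* Here [-1 < u < 0], so [- u] is a cosine; [cos theta < - u] places its angle below the absolute
   value of [theta], hence inside the stabilized range. *)
have uint : -1 <= - u <= 1 by lra.
have cosu := acosK uint.
have acos0 := acos_ge0 uint; have acospi := acos_lepi uint.
have cos_norm : cos `|theta| = cos theta.
  by have [_|_] := ger0P theta; rewrite ?cosN.
have acos_lt : acos (- u) < `|theta|.
  rewrite -ltr_cos ?in_itv/= ?acos0 ?acospi ?normr_ge0//=.
    by rewrite cosu cos_norm; lra.
  by rewrite (le_trans _ etapi)// ltW// ltr_norml.
have theta_lt : `|theta| < eta by rewrite ltr_norml.
have /sum_gt0 : - eta < acos (- u) < eta by lra.
rewrite -/u -/v sqrrN sin2cos2 cosu addNr mulr0 addr0.
rewrite (_ : _ + _ * v = - (p * (1 - u ^+ 2))); last by ring.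
rewrite oppr_gt0 pmulr_rlt0// subr_lt0; have : 0 < (1 + u) * (1 - u) by rewrite mulr_gt0//; lra.
by rewrite mulrC -subr_sqr expr1n subr_gt0 => /lt_trans h /h; rewrite ltxx.
Qed.

(** * Computing the margins as suprema *)

Lemma of_type_P (R : realType) X (kp : R) : of_type X (PID_controller kp 0 0).
Proof.
by case: X; [exists kp|exists kp, 0|exists kp, 0|exists kp, 0, 0].
Qed.

Lemma of_type_PD (R : realType) (kp kd : R) X : X = TPD \/ X = TPID ->
  of_type X (PID_controller kp 0 kd).
Proof. by case=> ->; [exists kp, kd|exists kp, 0, kd]. Qed.

Section Margins.
Context (R : realType) (X : controller_type) (NP DP : {poly R}).

(** Controllers are asked only for [mu < v]: the supremum need not be attained, and the controller
    may depend on [mu]. *)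
Lemma gain_margin_eq (v : R) :
  (forall (mu : R) K, of_type X K ->
     (forall alpha : R, 1 <= alpha < mu -> stabilizes NP DP alpha%:C K) ->
     mu <= v) ->
  (forall mu : R, mu < v -> exists2 K, of_type X K &
     forall alpha : R, 1 <= alpha < mu -> stabilizes NP DP alpha%:C K) ->
  gain_margin X NP DP = v%:E.
Proof.
move=> ub lb; apply/eqP; rewrite eq_le; apply/andP; split.
  by apply: ge_ereal_sup => _ [mu [K [XK H]] <-]; rewrite lee_fin (ub _ K).
apply/lee_addgt0Pr => e e0; rewrite -leeBlDr//.
have [|K XK H] := lb (v - e); first by rewrite ltrBlDr ltrDl.
by apply: ereal_sup_ubound; exists (v - e) => //; exists K.
Qed.

Lemma gain_margin_infty :
  (exists2 K, of_type X K &
     forall alpha : R, 1 <= alpha -> stabilizes NP DP alpha%:C K) ->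
  gain_margin X NP DP = +oo%E.
Proof.
move=> [K XK H]; apply: eq_infty => mu; apply: ereal_sup_ubound.
by exists mu => //; exists K; split=> // alpha /andP[? _]; exact: H.
Qed.

Lemma phase_margin_eq (v : R) : 0 <= v <= pi ->
  (forall (eta : R) K, 0 <= eta <= pi -> of_type X K ->
     (forall theta : R, - eta < theta < eta ->
        stabilizes NP DP (cos theta -i* sin theta) K) ->
     eta <= v) ->
  (forall eta : R, 0 <= eta < v -> exists2 K, of_type X K &
     forall theta : R, - eta < theta < eta ->
        stabilizes NP DP (cos theta -i* sin theta) K) ->
  phase_margin X NP DP = v.
Proof.
move=> /andP[v0 vpi] ub lb; rewrite /phase_margin; set S := (S in sup S).
have S0 : S 0.
  split; first by rewrite lexx pi_ge0.
  exists (PID_controller 0 0 0); split; first exact: of_type_P.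
  move=> theta; lra.
have ubS : ubound S v by move=> eta [etapi [K [XK H]]]; exact: (ub _ K).
have hubS : has_ubound S by exists v.
have s0 : 0 <= sup S by exact: ub_le_sup.
apply/eqP; rewrite eq_le ge_sup//=; last by exists 0.
rewrite leNgt; apply/negP => sv.
(* The midpoint would be an attained value above the supremum. *)
have [|K XK H] := lb ((sup S + v) / 2); first by lra.
have : (sup S + v) / 2 <= sup S.
  apply: ub_le_sup => //; split; first by lra.
  by exists K.
lra.
Qed.

End Margins.

(** * Margins for [beta0 > 0] and [beta1 < 0] *)

Lemma of_type_PI (R : realType) X : X = TP \/ X = TPI ->
  forall K : {fraction {poly R}}, of_type X K ->
  exists kp ki, K = PID_controller kp ki 0.
Proof. by case=> -> K /= [kp]; [exists kp, 0|case=> ki; exists kp, ki]. Qed.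

Lemma cos_lt_norm (R : realType) (theta eta : R) :
  - eta < theta < eta -> eta <= pi -> cos eta < cos theta.
Proof.
rewrite -ltr_norml => lt_eta eta_pi.
have -> : cos theta = cos `|theta| by have [_|_] := ger0P theta; rewrite ?cosN.
have ? := normr_ge0 theta.
by rewrite ltr_cos// in_itv /=; apply/andP; split; lra.
Qed.

(** With [t = - kp] and [m = - beta1], P control is stable at gain [a] exactly when [a * t] lies
    strictly between [1 / beta0] and [p / m]. A range of gains from 1 to [mu] fits there only up to
    the ratio of the larger endpoint to the smaller. *)
Lemma gain_margin_PI_neg (R : realType) (p beta0 beta1 : R) X :
  X = TP \/ X = TPI -> 0 < p -> 0 < beta0 -> beta1 < 0 ->
  gain_margin X (beta0 *: 'X + beta1%:P) ('X - p%:P)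
    = (Num.max (`|beta1| / beta0 / p) (p / (`|beta1| / beta0)))%:E.
Proof.
move=> /(@of_type_PI R) XPI p0 b0 b1; rewrite ltr0_norm//.
have [m m0 ->] : exists2 m : R, 0 < m & beta1 = - m.
  by exists (- beta1); rewrite ?opprK ?oppr_gt0.
rewrite opprK invf_div mulrA; set M := Num.max _ _.
have M_ge1 : m <= M * p * beta0.
  by rewrite -!ler_pdivrMr// le_max lexx.
have M_ge2 : p * beta0 <= M * m by rewrite -ler_pdivrMr// le_max lexx orbT.
have M1 : 1 <= M.
  rewrite leNgt; apply/negP => M1.
  have h1 : M * m < m by rewrite gtr_pMl.
  have h2 : M * (p * beta0) < p * beta0 by rewrite gtr_pMl// mulr_gt0.
  by rewrite mulrA in h2; lra.
apply: gain_margin_eq => [mu K /XPI[kp [ki ->]] H|mu].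
  rewrite leNgt; apply/negP => Mmu.
  have b1m : - m < 0 by rewrite oppr_lt0.
  have stP a : 1 <= a < mu ->
      0 < (1 - a * (beta0 * - kp)) * (a * (m * - kp) - p).
    move=> /H /(stabilizes_PI_P_real b0 b1m)/stabilizes_P.
    by rewrite expr0n /= !mul0r addr0 !(mulrN, mulNr, opprK).
  move: stP; set t := - kp => stP.
  (* The gains 1 and [M] alone are contradictory; the sign of [1 - beta0 * t] tells which endpoint
     would be the upper one. *)
  have st1 : 0 < (1 - beta0 * t) * (m * t - p).
    by have := stP 1; rewrite !mul1r; apply; lra.
  have stM : 0 < (1 - M * (beta0 * t)) * (M * (m * t) - p) by apply: stP; lra.
  have t0 : 0 < t.
    rewrite ltNge; apply/negP => t0.
    have ? : beta0 * t <= 0 by rewrite pmulr_rle0.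
    have ? : m * t <= 0 by rewrite pmulr_rle0.
    by rewrite pmulr_rgt0 in st1; lra.
  have tM1 : m * t <= (M * (beta0 * t)) * p.
    have := ler_wpM2r (ltW t0) M_ge1; congr (_ <= _); ring.
  have tM2 : (beta0 * t) * p <= M * (m * t).
    have := ler_wpM2r (ltW t0) M_ge2; rewrite mulrA mulrAC; congr (_ <= _); ring.
  have bt0 : 0 < beta0 * t by rewrite mulr_gt0.
  have mt0 : 0 < m * t by rewrite mulr_gt0.
  have bMt : beta0 * t <= M * (beta0 * t) by rewrite ler_peMl// ltW.
  have mMt : m * t <= M * (m * t) by rewrite ler_peMl// ltW.
  have [bt1|bt1] := ltP (beta0 * t) 1.
    rewrite pmulr_rgt0 in st1; last lra.
    rewrite pmulr_lgt0 in stM; last lra.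
    have : M * (beta0 * t) * p < p by rewrite gtr_pMl//; lra.
    lra.
  have {}bt1 : 1 < beta0 * t.
    rewrite lt_neqAle bt1 andbT; apply: contraTneq st1 => <-.
    by rewrite subrr mul0r ltxx.
  rewrite nmulr_rgt0 in st1; last lra.
  rewrite nmulr_rgt0 in stM; last lra.
  have : p < beta0 * t * p by rewrite ltr_pMl.
  lra.
move=> muM; have [mu1|mu1] := leP mu 1.
  by exists (PID_controller 0 0 0) => [|alpha]; [exact: of_type_P|lra].
have mu0 : 0 < mu by lra.
move: muM; rewrite lt_max => /orP[].
  rewrite !ltr_pdivlMr// => muM.
  (* Upper endpoint [1 / beta0]: this gain gives [mu * t = 1 / beta0]. *)
  exists (PID_controller (- (mu * beta0)^-1) 0 0); first exact: of_type_P.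
  move=> alpha /andP[a1 amu]; apply/stabilizes_P.
  have -> : alpha * (beta0 * - (mu * beta0)^-1) = - (alpha / mu).
    by field; rewrite !gt_eqF.
  have -> : alpha * (- m * - (mu * beta0)^-1) = alpha * (m / (mu * beta0)).
    by field; rewrite !gt_eqF.
  rewrite expr0n /= !mul0r addr0 mulr_gt0 ?subr_gt0//.
    by rewrite ltr_pdivrMr// mul1r.
  have : p < m / (mu * beta0).
    by rewrite ltr_pdivlMr ?mulr_gt0//; lra.
  move=> /lt_le_trans; apply; rewrite ler_peMl// ltW// divr_gt0// mulr_gt0//.
rewrite !ltr_pdivlMr// => muM.
(* Upper endpoint [p / m]: this gain gives [mu * t = p / m]. *)
exists (PID_controller (- (p / (mu * m))) 0 0); first exact: of_type_P.
move=> alpha /andP[a1 amu]; apply/stabilizes_P.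
have -> : alpha * (beta0 * - (p / (mu * m))) = - (alpha * (p * beta0 / (mu * m))).
  by field; rewrite !gt_eqF.
have -> : alpha * (- m * - (p / (mu * m))) = alpha / mu * p.
  by field; rewrite !gt_eqF.
rewrite expr0n /= !mul0r addr0 nmulr_rgt0 ?subr_lt0.
  by rewrite gtr_pMl// ltr_pdivrMr// mul1r.
have : 1 < p * beta0 / (mu * m) by rewrite ltr_pdivlMr ?mulr_gt0// mul1r.
move=> h; apply: (lt_le_trans h); rewrite ler_peMl// ltW// (lt_trans _ h)//.
Qed.

(** With [n = |beta1| / p], [q ^+ 2 = beta0 * n] and [t = - kp], P control is stable at [theta] iff
    [1 + (q * t) ^+ 2 < cos theta * t * (beta0 + n)]. Since [1 + (q * t) ^+ 2 >= 2 * q * t], with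
    equality at [t = 1 / q], the best gain is [- 1 / q]. *)
Lemma phase_margin_PI_neg (R : realType) (p beta0 beta1 : R) X :
  X = TP \/ X = TPI -> 0 < p -> 0 < beta0 -> beta1 < 0 ->
  phase_margin X (beta0 *: 'X + beta1%:P) ('X - p%:P)
    = acos (2 * Num.sqrt (beta0 * `|beta1| / p) / (beta0 + `|beta1| / p)).
Proof.
move=> /(@of_type_PI R) XPI p0 b0 b1.
have [n n0 b1E] : exists2 n : R, 0 < n & beta1 = - (n * p).
  exists (- beta1 / p); first by rewrite divr_gt0// oppr_gt0.
  by rewrite divfK ?gt_eqF// opprK.
rewrite b1E normrN gtr0_norm ?mulr_gt0// -[beta0 * _ / p]mulrA mulfK ?gt_eqF//.
set q := Num.sqrt _.
have q0 : 0 < q by rewrite sqrtr_gt0 mulr_gt0.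
have q2 : q ^+ 2 = beta0 * n by rewrite sqr_sqrtr// ltW// mulr_gt0.
have d0 : 0 < beta0 + n by rewrite addr_gt0.
have P_cond kp theta :
    stabilizes (beta0 *: 'X + (- (n * p))%:P) ('X - p%:P)
      (cos theta -i* sin theta) (PID_controller kp 0 0) <->
    1 + q ^+ 2 * kp ^+ 2 < cos theta * - kp * (beta0 + n).
  apply: (iff_trans (stabilizes_P _ _ _ _ _ _)).
  rewrite -(subr_gt0 (1 + _)) -[in X in _ <-> X](pmulr_rgt0 _ p0).
  rewrite sqrrN sin2cos2 q2.
  by rewrite (_ : _ + _ * (- _ * _) = p * (cos theta * - kp * (beta0 + n)
    - (1 + beta0 * n * kp ^+ 2)))//; ring.
set x := 2 * q / _.
(* The upper bound is the inequality of arithmetic and geometric means for [beta0] and [n]. *)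
have x_int : -1 <= x <= 1.
  apply/andP; split; first by rewrite (@le_trans _ _ 0)// ?lerN10// ltW// divr_gt0// mulr_gt0//.
  rewrite ler_pdivrMr// mul1r -(ler_pXn2r (ltn0Sn 1)) ?nnegrE ?(ltW d0) ?mulr_ge0 ?(ltW q0)//.
  by rewrite exprMn q2; have := sqr_ge0 (beta0 - n); lra.
have xd : x * (beta0 + n) = 2 * q by rewrite divfK// gt_eqF.
have acos0 := acos_ge0 x_int; have acospi := acos_lepi x_int.
apply: phase_margin_eq => [|eta K /andP[eta0 etapi] /XPI[kp [ki ->]] H|].
- by rewrite acos0.
- rewrite leNgt; apply/negP => lt_eta.
  have b1n : - (n * p) < 0 by rewrite oppr_lt0 mulr_gt0.
  have range : - eta < acos x < eta by lra.
  have /P_cond := stabilizes_PI_P_phase p0 b0 b1n etapi H range.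
  (* At the angle [acos x] the condition would read [(1 + q * kp) ^+ 2 < 0]. *)
  rewrite acosK// [x * _ * _]mulrAC xd -exprMn.
  have := sqr_ge0 (1 + q * kp); lra.
- move=> eta /andP[eta0 lt_eta].
  exists (PID_controller (- q^-1) 0 0); first exact: of_type_P.
  move=> theta range; apply/P_cond; rewrite opprK sqrrN -exprMn divff ?gt_eqF// expr1n.
  have : cos (acos x) < cos theta by apply: cos_lt_norm => //; lra.
  rewrite acosK// -(ltr_pM2r d0) xd -(ltr_pM2r (_ : 0 < q^-1)) ?invr_gt0//.
  by rewrite mulfK ?gt_eqF// [cos theta * _ * _]mulrAC.
Qed.

(** * Margins for [beta1 > 0] *)

Lemma gain_margin_pos (R : realType) (p beta0 beta1 : R) X :
  0 < p -> 0 <= beta0 -> 0 < beta1 ->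
  gain_margin X (beta0 *: 'X + beta1%:P) ('X - p%:P) = +oo%E.
Proof.
move=> p0 b0 b1; apply: gain_margin_infty.
(* This gain gives [alpha * (beta1 * kp) = 2 * alpha * p > p]. *)
exists (PID_controller (2 * p / beta1) 0 0); first exact: of_type_P.
move=> alpha a1; apply/stabilizes_P; rewrite expr0n /= !mul0r addr0.
rewrite [beta1 * _]mulrC divfK ?gt_eqF// mulr_gt0//; last first.
  by have : p <= alpha * p; [rewrite ler_peMl// ltW|lra].
by rewrite ltr_wpDr// !mulr_ge0 ?invr_ge0 ?(ltW p0) ?(ltW b1)//; lra.
Qed.

(** High gain works at all angles at once: on the unit circle the coefficient of [kp ^+ 2] in the P
    condition is [beta0 * beta1 > 0], whatever the angle. *)
Lemma phase_margin_pos (R : realType) (p beta0 beta1 : R) X :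
  0 < p -> 0 < beta0 -> 0 < beta1 ->
  phase_margin X (beta0 *: 'X + beta1%:P) ('X - p%:P) = pi.
Proof.
move=> p0 b0 b1; apply: phase_margin_eq => [|eta K /andP[]//|eta _].
  by rewrite pi_ge0 lexx.
(* This [k] turns the condition into a sum of terms weighted by [1 + cos theta], [1 - cos theta] and
   [k - 1], all nonnegative, plus a positive constant. *)
have [k k1 kE] : exists2 k : R, 1 <= k &
    beta0 * beta1 * k = beta0 * beta1 + (beta1 + p * beta0 + p).
  exists (1 + (beta1 + p * beta0 + p) / (beta0 * beta1)).
    by rewrite lerDl ltW// divr_gt0 ?mulr_gt0// !addr_gt0 ?mulr_gt0.
  by field; rewrite !gt_eqF.
exists (PID_controller k 0 0); first exact: of_type_P.
move=> theta _; apply/stabilizes_P; rewrite sqrrN sin2cos2.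
rewrite (_ : _ + _ * (beta1 * k) = k * (beta0 * beta1 + (1 + cos theta) * beta1
  + (1 - cos theta) * (p * beta0)) + p * (k - 1)); last first.
  rewrite (_ : _ + _ * (beta1 * k) = k * (beta0 * beta1 * k) + k * cos theta *
    (beta1 - p * beta0) - p); last by ring.
  by rewrite kE; ring.
have ? := cos_le1 theta; have ? := cos_geN1 theta.
rewrite ltr_wpDr ?mulr_ge0 ?(ltW p0) ?subr_ge0// mulr_gt0//; first lra.
by rewrite ltr_wpDr ?ltr_wpDr ?mulr_ge0 ?mulr_gt0 ?(ltW b0) ?(ltW b1) ?(ltW p0)//; lra.
Qed.

(** * Margins for a constant numerator *)

Lemma gain_margin_const (R : realType) (p beta1 : R) X :
  0 < p -> beta1 != 0 ->
  gain_margin X (0 *: 'X + beta1%:P) ('X - p%:P) = +oo%E.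
Proof.
move=> p0 b1; apply: gain_margin_infty.
exists (PID_controller (2 * p / beta1) 0 0); first exact: of_type_P.
move=> alpha a1; apply/stabilizes_P; rewrite expr0n /= !mul0r addr0.
rewrite [beta1 * _]mulrC divfK// mulr0 addr0 mul1r.
by have : p <= alpha * p; [rewrite ler_peMl// ltW|lra].
Qed.

(** The condition reduces to [p < cos theta * (beta1 * kp)]. It fails at [pi / 2] for every gain,
    while below [eta < pi / 2] it holds with [beta1 * kp = p / cos eta]. *)
Lemma phase_margin_const_P (R : realType) (p beta1 : R) :
  0 < p -> beta1 != 0 ->
  phase_margin TP (0 *: 'X + beta1%:P) ('X - p%:P) = pi / 2.
Proof.
move=> p0 b1; have pi0 := pi_gt0 R.
apply: phase_margin_eq => [|eta K _ [kp ->] H|eta /andP[eta0 lt_eta]].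
- lra.
- rewrite leNgt; apply/negP => lt_eta.
  have /H/stabilizes_P : - eta < pi / 2 < eta by lra.
  by rewrite cos_pihalf !(mul0r, mulr0, addr0, mul1r, add0r); lra.
- have cos0 : 0 < cos eta by rewrite cos_gt0_pihalf//; lra.
  exists (PID_controller (p / cos eta / beta1) 0 0); first exact: of_type_P.
  move=> theta range; apply/stabilizes_P.
  rewrite !mul0r !mulr0 mul0r !addr0 mul1r [beta1 * _]mulrC divfK// subr_gt0.
  rewrite mulrA ltr_pdivlMr// mulrC ltr_pM2r//.
  by apply: cos_lt_norm => //; lra.
Qed.

(* With [beta1 * K = 2 s + 2 p] the condition reads [3 p > 0] at every angle. *)
Lemma phase_margin_const_PD (R : realType) (p beta1 : R) X :
  X = TPD \/ X = TPID -> 0 < p -> beta1 != 0 ->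
  phase_margin X (0 *: 'X + beta1%:P) ('X - p%:P) = pi.
Proof.
move=> XPD p0 b1; apply: phase_margin_eq => [|eta K /andP[]//|eta _].
  by rewrite pi_ge0 lexx.
exists (PID_controller (2 * p / beta1) 0 (2 / beta1)); first exact: of_type_PD.
move=> theta _; apply/stabilizes_PD; first by rewrite mul0r.
rewrite mul0r add0r ![beta1 * _]mulrC !divfK// sqrrN sin2cos2.
rewrite (_ : _ + _ = 3 * p); last by ring.
by rewrite mulr_gt0.
Qed.

Theorem theorem3p1 (R : realType) (p beta0 beta1 : R)
    (hp : 0 < p) (hbeta0 : 0 <= beta0) (hbeta1 : beta1 != 0) :
  let NP : {poly R} := beta0 *: 'X + beta1%:P in
  let DP : {poly R} := 'X - p%:P in
  (0 < beta0 ->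
    [/\ gain_margin TPI NP DP = gain_margin TP NP DP,
        gain_margin TP NP DP =
          (if beta1 < 0 then
             (Num.max (`|beta1| / beta0 / p) (p / (`|beta1| / beta0)))%:E
           else +oo%E),
        phase_margin TPI NP DP = phase_margin TP NP DP &
        phase_margin TP NP DP =
          (if beta1 < 0 then
             acos (2 * Num.sqrt (beta0 * `|beta1| / p)
                   / (beta0 + `|beta1| / p))
           else pi)]) /\
  (beta0 = 0 ->
    [/\ gain_margin TPID NP DP = gain_margin TPD NP DP,
        gain_margin TPD NP DP = gain_margin TP NP DP &
        gain_margin TP NP DP = +oo%E] /\
    [/\ phase_margin TPID NP DP = phase_margin TPD NP DP,
        phase_margin TPD NP DP = 2 * phase_margin TP NP DP &
        2 * phase_margin TP NP DP = pi]).
Proof.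
move=> NP DP; split=> [b0|b0].
  have [b1|b1] := ltP beta1 0.
    by rewrite !gain_margin_PI_neg ?phase_margin_PI_neg//; auto.
  have {}b1 : 0 < beta1 by rewrite lt_neqAle eq_sym hbeta1.
  by rewrite !gain_margin_pos// !phase_margin_pos.
rewrite /NP b0 !gain_margin_const// phase_margin_const_P//.
rewrite !phase_margin_const_PD//; [|by left|by right].
by split; split=> //; field.
Qed.
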